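(* (In $\mathrm{ZFC}$.) There exists a countable Hausdorff Fréchet–Urysohn space $X$ without isolated points which is not $H$-separable.
   Context: A space $X$ is Fréchet–Urysohn if for every $A\subset X$ and $x\in\overline{A}\setminus A$ there is an infinite countable set $S\subset A\setminus\{x\}$ converging to $x$, i.e., such that $S\setminus U$ is finite for every open neighbourhood $U$ of $x$. A space $X$ is $H$-separable if for every sequence $\langle D_n:n\in\omega\rangle$ of dense subsets of $X$ there are finite sets $F_n\subset D_n$, $n\in\omega$, such that every nonempty open subset of $X$ meets all but finitely many of the $F_n$. *)

(* Defs.v *)
From mathcomp Require Import all_boot all_order.
From mathcomp Require Import boolp classical_sets functions cardinality filter.
From mathcomp Require Import topology.

Set Implicit Arguments.
Unset Strict Implicit.
Unset Printing Implicit Defensive.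

Local Open Scope classical_set_scope.

Definition frechet_urysohn (X : topologicalType) : Prop :=
  forall (A : set X) (x : X), (closure A `\` A) x ->
    exists S : set X,
      [/\ infinite_set S, countable S, S `<=` A `\ x &
          forall U : set X, open U -> U x -> finite_set (S `\` U)].

(* Finiteness of the exceptional set counts indices [n], so a finite set that
   occurs as [F n] for several [n] is counted once for each of them. *)
Definition H_separable (X : topologicalType) : Prop :=
  forall D : nat -> set X, (forall n, dense (D n)) ->
    exists F : nat -> set X,
      (forall n, finite_set (F n) /\ F n `<=` D n) /\
      (forall U : set X, open U -> U !=set0 ->
         finite_set [set n | ~ (U `&` F n !=set0)]).

(* Main.v *)
Require Import Defs.
From HB Require Import structures.
From mathcomp Require Import all_boot all_order.
From mathcomp Require Import boolp classical_sets functions cardinality filter.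
From mathcomp Require Import topology.

(** The space is [nat] with the 2-adic topology, refined by making every set of
    an ideal closed and nowhere dense. Split [nat] into 2-adically dense sets
    [E s] indexed by the nodes [s] of the binary tree. The ideal is generated
    by the finite sets and the sets that live on the [E s] with [s] on a single
    branch and meet every such [E s] in a finite set.

    Given finite [F s] inside [E s], some branch set is the union of the [F s]
    along a branch, so its complement is an open set missing infinitely many
    of them. For the Fréchet-Urysohn property one has a decreasing sequence
    [A k] of sets outside the ideal. If some [E s] meets all of them in
    infinite sets, choose points inside that [E s]. Otherwise there is a
    branch [g] such that the part of each [A k] above each node of [g] is
    outside the ideal; choose the k-th point above the k-th node of [g] but
    off the sets of the ideal living on [g]. A set living on another branch
    contains only finitely many of these points. *)

Set Implicit Arguments.
Unset Strict Implicit.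
Unset Printing Implicit Defensive.

Local Open Scope classical_set_scope.

(** * Finite and infinite sets of natural numbers *)

Lemma finite_set_nat_bounded (A : set nat) :
  finite_set A -> exists m, forall x, A x -> x < m.
Proof.
move=> /finite_seqP[s ->]; exists (\max_(i <- s) i).+1 => x /= xs.
by rewrite ltnS; exact: leq_bigmax_seq.
Qed.

Lemma infinite_set_nat_ge (A : set nat) (k : nat) :
  infinite_set A -> exists x, A x /\ k <= x.
Proof.
move=> Ainf; apply: contrapT => /forallNP noA; apply: Ainf.
apply: (sub_finite_set _ (finite_II k)) => x Ax /=.
by rewrite ltnNge; apply/negP => kx; apply: (noA x).
Qed.

Lemma infinite_range_geid (a : nat -> nat) :
  (forall k, k <= a k) -> infinite_set (range a).
Proof.
move=> a_ge /finite_set_nat_bounded[m am].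
by have := am (a m) (ex_intro2 _ _ m I erefl); rewrite ltnNge a_ge.
Qed.

Lemma finite_range_prefix (T : Type) (a : nat -> T) (k : nat) (B : set T) :
  (forall j, k <= j -> ~ B (a j)) -> finite_set (range a `&` B).
Proof.
move=> aB; apply: (@sub_finite_set _ _ (a @` `I_k)).
  move=> _ [[j _ <-] Bj]; exists j => //=.
  by rewrite ltnNge; apply/negP => /aB.
exact/finite_image/finite_II.
Qed.

(** * Residue classes modulo powers of 2 *)

Definition near (k x : nat) : set nat := [set y | y = x %[mod 2 ^ k]].

Lemma near_eq k x y : near k x y -> near k y = near k x.
Proof. by rewrite /near /= => ->. Qed.

Lemma near_sub k m x : k <= m -> near m x `<=` near k x.
Proof.
move=> km y /= yx; rewrite /near /=.
have d := dvdn_exp2l 2 km.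
by rewrite -(modn_dvdm y d) yx modn_dvdm.
Qed.

Lemma near_separated x y : x != y -> near (x + y) x `&` near (x + y) y = set0.
Proof.
move=> xy; apply/seteqP; split => // z [] /= zx; rewrite /near /= zx.
(* Both points lie below the modulus, so they are their own residues. *)
have lt2 := ltn_expl (x + y) (ltnSn 1).
rewrite !modn_small; first by move=> e; rewrite e eqxx in xy.
  exact: leq_ltn_trans (leq_addl _ _) lt2.
exact: leq_ltn_trans (leq_addr _ _) lt2.
Qed.

(** * Fibres over the nodes of the binary tree *)

Definition node (n : nat) : seq bool := odflt [::] (unpickle n).

Lemma nodeK s : node (pickle s) = s.
Proof. by rewrite /node pickleK. Qed.

(* Every residue class modulo [2 ^ k] meets every fibre of [lab] in an infinite
   set, since its elements can have any large enough leading binary digit. *)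
Definition lab (x : nat) : seq bool := node (logn 2 (trunc_log 2 x)).

Lemma infinite_near_lab k x s : infinite_set (near k x `&` [set y | lab y = s]).
Proof.
move=> /finite_set_nat_bounded[m bound].
(* The odd cofactor gives [j] the 2-adic valuation [pickle s]; its size makes [2 ^ j] vanish modulo
   [2 ^ k] and exceed [m]. *)
pose j := 2 ^ pickle s * (2 * (k + m)).+1.
have kmj : k + m <= j.
  apply: leq_trans (leq_pmull _ (expn_gt0 2 _)).
  by rewrite ltnW // ltnS mulSn leq_addr.
pose y := 2 ^ j + x %% 2 ^ k.
have r_lt : x %% 2 ^ k < 2 ^ j.
  apply: (@leq_trans (2 ^ k)); first by rewrite ltn_mod expn_gt0.
  by rewrite leq_exp2l // (leq_trans (leq_addr m k)).
have logy : trunc_log 2 y = j.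
  apply: trunc_log_eq => //; rewrite leq_addr /=.
  by rewrite expnS mul2n -addnn ltn_add2l.
have : y < m.
  apply: bound; split.
    rewrite /near /= /y -modnDml.
    rewrite (eqP (dvdn_exp2l 2 (leq_trans (leq_addr m k) kmj))).
    by rewrite add0n modn_mod.
  rewrite /= /lab logy lognM ?expn_gt0 // pfactorK //.
  by rewrite lognE /= dvdn2 /= oddM /= addn0 nodeK.
rewrite ltnNge; apply/negP/negPn.
apply: leq_trans (leq_addr _ _); apply: ltnW.
by apply: leq_ltn_trans (ltn_expl _ _) => //; apply: leq_trans kmj; rewrite leq_addl.
Qed.

(** * The ideal of small sets *)

Definition fibrewise_finite (g : nat -> bool) : Prop :=
  forall s, finite_set [set x | lab x = s /\ g x].

(* The Boolean sequence [g] plays two roles: it is a branch of the tree, and it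
   is the indicator function of a subset of [nat], so that every fibrewise
   finite set occurs on some branch. *)
Definition trace (g : nat -> bool) : set nat :=
  [set x | [/\ fibrewise_finite g, lab x = mkseq g (size (lab x)) & g x]].

Inductive small : set nat -> Prop :=
| small_finite A of finite_set A : small A
| small_trace g : small (trace g)
| small_sub A B of A `<=` B & small B : small A
| smallU A B of small A & small B : small (A `|` B).

(** The sets meeting [S] in a finite set form an ideal containing all finite sets, so only the other
    generators need checking. *)
Lemma small_ind_finite (S : set nat) :
  (forall g, finite_set (S `&` trace g)) ->
  forall N, small N -> finite_set (S `&` N).
Proof.
move=> Strace N; elim=> {N} [A Afin|//|A B AB _ IH|A B _ IHA _ IHB].
- exact: sub_finite_set Afin.
- by apply: sub_finite_set IH => x [Sx /AB].
- by rewrite setIUr finite_setU.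
Qed.

Lemma finite_lab_small s N : small N -> finite_set ([set x | lab x = s] `&` N).
Proof.
apply: small_ind_finite => g.
have [gfin|ngfin] := pselect (fibrewise_finite g).
  by apply: sub_finite_set (gfin s) => x [xs [_ _ gx]].
(* Without fibrewise finiteness, [trace g] is empty. *)
by apply: (@sub_finite_set _ _ set0) => // x [_ []].
Qed.

Lemma near_not_small_lab k x s N : small N ->
  exists y, [/\ near k x y, lab y = s & ~ N y].
Proof.
move=> sN; apply: contrapT => no.
apply: (@infinite_near_lab k x s); apply: sub_finite_set (finite_lab_small s sN).
move=> y [ny ly]; split=> //; apply: contrapT => nN; apply: no.
by exists y.
Qed.

Lemma not_small_infinite A : ~ small A -> infinite_set A.
Proof. by move=> nA /small_finite. Qed.

Lemma not_smallD A N : ~ small A -> small N -> ~ small (A `\` N).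
Proof.
move=> nA sN sD; apply: nA; apply: small_sub (smallU sD sN) => x Ax.
by have [|] := pselect (N x); [right|left].
Qed.

(** * Selection from decreasing sequences outside the ideal *)

Definition above (s : seq bool) : set nat := [set x | prefix s (lab x)].

Section pseudointersection.
Variable A : nat -> set nat.
Hypothesis A_decr : forall k m, k <= m -> A m `<=` A k.

Definition big (s : seq bool) : Prop := forall k, ~ small (A k `&` above s).

(** The part above [s] splits into the fibre over [s] and the parts above its two children; were
    neither child big, all three would be small at a common index. *)
Lemma big_rcons s :
  (exists k, finite_set (A k `&` [set x | lab x = s])) -> big s ->
  exists b, big (rcons s b).
Proof.
move=> [k kfin] sbig; apply: contrapT => /forallNP nb.
have /existsNP[k0 /contrapT sm0] := nb false.
have /existsNP[k1 /contrapT sm1] := nb true.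
pose m := maxn k (maxn k0 k1).
have km : k <= m by rewrite leq_maxl.
have k0m : k0 <= m by rewrite /m maxnCA leq_maxl.
have k1m : k1 <= m by rewrite /m (maxnC k0) maxnCA leq_maxl.
apply: (sbig m); apply: small_sub (smallU (small_finite kfin) (smallU sm0 sm1)).
move=> x [Am /prefixP[[|[] t] xt]].
- by left; split; [exact: A_decr Am|rewrite /= xt cats0].
- right; right; split; first exact: A_decr Am.
  by rewrite /above /= xt -cat_rcons prefix_prefix.
- right; left; split; first exact: A_decr Am.
  by rewrite /above /= xt -cat_rcons prefix_prefix.
Qed.

Lemma big_branch :
  (forall s, exists k, finite_set (A k `&` [set x | lab x = s])) ->
  (forall k, ~ small (A k)) -> exists g, forall n, big (mkseq g n).
Proof.
move=> Afin nsmall.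
have /choice[h hbig] s : exists b, big s -> big (rcons s b).
  have [sbig|] := pselect (big s); last by exists true.
  by have [b bbig] := big_rcons (Afin s) sbig; exists b.
pose st n := iter n (fun s => rcons s (h s)) [::].
exists (h \o st) => n.
have -> : mkseq (h \o st) n = st n by elim: n => // n IH; rewrite mkseqS IH.
elim: n => [k|n IH]; last exact: hbig.
by apply: contra_not (nsmall k); apply: small_sub => x; split=> //=; exact: prefix0s.
Qed.

Lemma pseudointersection : (forall k, ~ small (A k)) ->
  exists a : nat -> nat, [/\ forall k, A k (a k), infinite_set (range a) &
    forall N, small N -> finite_set (range a `&` N)].
Proof.
move=> nsmall.
have [[s sinf]|/forallNP nos] :=
    pselect (exists s, forall k, infinite_set (A k `&` [set x | lab x = s])).
  have /choice[a aP] k := infinite_set_nat_ge k (sinf k).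
  exists a; split=> [k||N sN]; first by have [[]] := aP k.
    by apply: infinite_range_geid => k; have [] := aP k.
  apply: sub_finite_set (finite_lab_small s sN) => _ [[k _ <-] Nk].
  by split=> //; have [[]] := aP k.
have Afin s : exists k, finite_set (A k `&` [set x | lab x = s]).
  by have /existsNP[k /contrapT] := nos s; exists k.
have [g gbig] := big_branch Afin nsmall.
have /choice[a aP] k : exists x,
    ((A k `&` above (mkseq g k)) `\` trace g) x /\ k <= x.
  apply/infinite_set_nat_ge/not_small_infinite/not_smallD; first exact: gbig.
  exact: small_trace.
exists a; split=> [k||]; first by have [[[]]] := aP k.
  by apply: infinite_range_geid => k; have [] := aP k.
apply: small_ind_finite => h; have [<-|] := pselect (g = h).
  by apply: (@finite_range_prefix _ _ 0) => j _; have [[]] := aP j.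
move=> gh; have [n gn] : exists n, g n <> h n.
  by apply/existsNP => gh'; apply: gh; apply/funext.
(* For [j > n] the label of [a j] extends [mkseq g j], so its entry [n] is [g n], whereas membership
   in [trace h] makes it [h n]. *)
apply: (@finite_range_prefix _ _ n.+1) => j nj [_ hj _]; apply: gn.
have [[[_ /prefixP[t labE]] _] _] := aP j.
have n_lt : n < size (lab (a j)) by rewrite labE size_cat size_mkseq ltn_addr.
have := congr1 (fun s => nth false s n) labE.
by rewrite {1}hj nth_cat size_mkseq nj !nth_mkseq.
Qed.

End pseudointersection.

(** * The topology and its properties *)

Definition tree_space : Type := nat.

HB.instance Definition _ := Choice.copy tree_space nat.

Definition tree_open (W : set tree_space) : Prop :=
  forall x, W x -> exists k N, small N /\ near k x `\` N `<=` W.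

Lemma tree_openT : tree_open setT.
Proof. by move=> x _; exists 0, set0; split=> //; exact: small_finite. Qed.

Lemma tree_openI : setI_closed tree_open.
Proof.
move=> V W oV oW x [/oV[k [M [sM kV]]] /oW[m [N [sN mW]]]].
exists (maxn k m), (M `|` N); split; first exact: smallU.
move=> y [ny /not_orP[nM nN]]; split.
  by apply: kV; split=> //; apply: near_sub ny; rewrite leq_maxl.
by apply: mW; split=> //; apply: near_sub ny; rewrite leq_maxr.
Qed.

Lemma tree_open_bigU (I : Type) (f : I -> set tree_space) :
  (forall i, tree_open (f i)) -> tree_open (\bigcup_i f i).
Proof.
move=> fo x [i _ /fo[k [N [sN kf]]]].
by exists k, N; split=> // y /kf; exists i.
Qed.

HB.instance Definition _ :=
  isOpenTopological.Build tree_space tree_openT tree_openI tree_open_bigU.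

Lemma tree_space_openE (W : set tree_space) : open W = tree_open W.
Proof. by []. Qed.

Lemma open_nearD k x N : small N -> open (x |` (near k x `\` N) : set tree_space).
Proof.
rewrite tree_space_openE => sN y yx; exists k, N; split=> // z [zy nN]; right; split=> //.
by case: yx => [<-//|[/near_eq <-]].
Qed.

Lemma near_open k x : open (near k x : set tree_space).
Proof.
rewrite tree_space_openE => y /near_eq <-; exists k, set0.
by split=> [|z []//]; exact: small_finite.
Qed.

Lemma dense_lab s : dense ([set x | lab x = s] : set tree_space).
Proof.
move=> O [x Ox]; rewrite tree_space_openE => /(_ x Ox)[k [N [sN kO]]].
have [y [ny ly nN]] := near_not_small_lab k x s sN.
by exists y; split=> //; apply: kO.
Qed.

Lemma tree_space_hausdorff : hausdorff_space tree_space.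
Proof.
rewrite open_hausdorff => x y xy.
exists (near (x + y) x, near (x + y) y); rewrite ?inE //=.
by split; [exact: near_open..|rewrite near_separated].
Qed.

Lemma tree_space_no_isolated : isolated [set: tree_space] = set0.
Proof.
apply/seteqP; split=> // x [_ [V]]; rewrite nbhsE => -[W [oW Wx] WV].
rewrite setIT => Vx.
move: oW; rewrite tree_space_openE => /(_ x Wx)[k [N [sN kW]]].
(* Adding [x] to the small set forces [y] to differ from [x]; the label [[::]] is an arbitrary
   choice. *)
have [y [ny _ nNx]] : exists y, [/\ near k x y, lab y = [::] & ~ (N `|` [set x]) y].
  by apply/near_not_small_lab/smallU => //; exact/small_finite.
have Vy : V y by apply/WV/kW; split=> // Ny; apply: nNx; left.
by apply: nNx; right; rewrite -Vx.
Qed.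

Lemma tree_space_frechet_urysohn : frechet_urysohn tree_space.
Proof.
move=> A x [clAx nAx].
have A_decr k m : k <= m -> A `&` near m x `<=` A `&` near k x.
  by move=> km; apply: setIS; exact: near_sub.
(* Otherwise, removing this set from the ball around [x] would leave a neighbourhood of [x] disjoint
   from [A]. *)
have nsmall k : ~ small (A `&` near k x).
  move=> sA.
  have [|y [Ay [yx|[ny]]]] := clAx (x |` (near k x `\` (A `&` near k x))).
  - by apply: open_nbhs_nbhs; split; [exact: open_nearD|left].
  - by apply: nAx; rewrite -yx.
  - by apply; split.
have [a [aA ainf aN]] := pseudointersection A_decr nsmall.
exists (range a); split=> //.
- by apply: sub_countable (countableP [set: nat]); exact: card_image_le.
- move=> _ [k _ <-]; have [Ak _] := aA k; split=> // akx.
  by apply: nAx; rewrite -akx.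
move=> U; rewrite tree_space_openE => oU /oU[k [N [sN kU]]].
apply: (@sub_finite_set _ _ ((range a `&` N) `|` (range a `&` ~` near k x))).
  move=> y [ay nU]; have [Ny|nN] := pselect (N y); [by left|right].
  by split=> // ny; apply: nU; apply: kU.
rewrite finite_setU; split; first exact: aN.
apply: (@finite_range_prefix _ _ k) => j kj; apply.
by have [_] := aA j; exact: near_sub.
Qed.

Lemma tree_space_not_H_separable : ~ H_separable tree_space.
Proof.
move=> /(_ (fun n => [set x | lab x = node n]) (fun n => dense_lab (node n))).
move=> [F [FP meets]].
(* The union of the chosen finite sets, one for each node, serves as its own branch. *)
pose g x := `[< F (pickle (lab x)) x >].
have gfin : fibrewise_finite g.
  move=> s; apply: sub_finite_set (FP (pickle s)).1.
  by move=> x [<- /asboolP].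
have oU : open (~` trace g : set tree_space).
  rewrite tree_space_openE => x nx; exists 0, (trace g); split=> [|y []//]; exact: small_trace.
have U0 : (~` trace g : set tree_space) !=set0.
  by have [y [_ _]] := near_not_small_lab 0 0 [::] (small_trace g); exists y.
have finm := meets _ oU U0.
(* The nodes on the branch [g] have infinitely many indices [c n], and each [F (c n)] lies inside
   [trace g]. *)
apply: infinite_nat; pose c n := pickle (mkseq g n).
have c_inj : injective c.
  move=> i j /(congr1 node); rewrite !nodeK => /(congr1 size).
  by rewrite !size_mkseq.
apply: sub_finite_set (finite_preimage (in2W c_inj) finm) => n _ /= [x [nx Fx]].
have := (FP (c n)).2 x Fx; rewrite /= /c nodeK => labx.
by apply: nx; split=> //; [rewrite labx size_mkseq|apply/asboolP; rewrite labx].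
Qed.

Theorem theorem2p1 :
  exists X : topologicalType,
    [/\ countable [set: X], hausdorff_space X, frechet_urysohn X,
        isolated [set: X] = set0 & ~ H_separable X].
Proof.
exists tree_space; split.
- exact: (countableP [set: nat]).
- exact: tree_space_hausdorff.
- exact: tree_space_frechet_urysohn.
- exact: tree_space_no_isolated.
- exact: tree_space_not_H_separable.
Qed.
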